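(* Let $G$ be a discrete abelian group, $S=G\setminus\{0\}$, $p\in[1,\infty)$, and let $\mu_0,\mu_n\in\mathcal M$ $(n\in\mathbb N)$ be absolutely continuous with respect to $\lambda$. If $\mathrm{m}\text{-}\lim\mu_n=\mu_0$ and $d_p(\mu_0;S)=0$, then $\lim_{n\to\infty}d_p(\mu_n;S)=d_p(\mu_0;S)$.
   Context: $G$ is a discrete abelian group (written additively, $G\ne\{0\}$), $\Gamma$ is its compact dual group with normalized Haar measure $\lambda$, and for $x\in G$, $e_x:\Gamma\to\mathbb C$ is the character of $\Gamma$ generated by $x$. $\mathcal M$ is the set of all non-zero finite non-negative regular Borel measures on $\Gamma$. For $S\subseteq G\setminus\{0\}$ non-empty, $\mathcal T(S)$ is the complex linear space of all finite sums $\sum_j a_je_{x_j}$, $a_j\in\mathbb C$, $x_j\in S$, and $d_p(\mu;S):=\inf\{\int|1-\tau|^p\,d\mu:\tau\in\mathcal T(S)\}$. $\mathrm{m}\text{-}\lim\mu_n=\mu_0$ (convergence in measure) means: for some (equivalently, every) $\nu\in\mathcal M$ with $\mu_k\ll\nu$ for all $k\in\mathbb N_0$, the Radon-Nikodym derivatives $\frac{d\mu_n}{d\nu}$ converge to $\frac{d\mu_0}{d\nu}$ in measure $\nu$. *)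

(* Defs.v *)
From HB Require Import structures.
From mathcomp Require Import all_boot all_order all_algebra.
From mathcomp Require Import all_classical all_reals all_analysis.
From mathcomp Require Import complex.

Set Implicit Arguments.
Unset Strict Implicit.
Unset Printing Implicit Defensive.

Import Order.TTheory GRing.Theory Num.Theory.
Import numFieldNormedType.Exports.

Local Open Scope classical_set_scope.
Local Open Scope ring_scope.
Local Open Scope complex_scope.
Local Open Scope charge_scope.

(* The group G is discrete, so every homomorphism to the unit circle is
   continuous. *)
Record dual (R : realType) (G : zmodType) := Dual {
  dual_fun :> G -> R[i];
  dual_funD : forall x y, dual_fun (x + y) = dual_fun x * dual_fun y;
  dual_fun_norm : forall x, `|dual_fun x| = 1 }.

Section dual_structures.
Variables (R : realType) (G : zmodType).
Implicit Types g h : dual R G.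

Lemma dual_ext g h : dual_fun g =1 dual_fun h -> g = h.
Proof.
case: g h => [g gD gN] [h hD hN] /= /funext gh; subst h.
by congr Dual; exact: Prop_irrelevance.
Qed.

Lemma dual_fun_neq0 g x : g x != 0.
Proof. by rewrite -normr_eq0 dual_fun_norm oner_eq0. Qed.

HB.instance Definition _ := gen_eqMixin (dual R G).
HB.instance Definition _ := gen_choiceMixin (dual R G).

Definition dual_one : dual R G.
Proof.
apply: (@Dual R G (fun=> 1)) => [_ _|_]; first by rewrite mulr1.
exact: normr1.
Defined.

Definition dual_mul g h : dual R G.
Proof.
apply: (@Dual R G (fun x => g x * h x)) => [x y|x].
  by rewrite !dual_funD mulrACA.
by rewrite normrM !dual_fun_norm mulr1.
Defined.

Definition dual_inv g : dual R G.
Proof.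
apply: (@Dual R G (fun x => (g x)^-1)) => [x y|x].
  by rewrite dual_funD invfM.
by rewrite normfV dual_fun_norm invr1.
Defined.

Lemma dual_mulA : associative dual_mul.
Proof. by move=> f g h; apply: dual_ext => x /=; rewrite mulrA. Qed.

Lemma dual_mul1g : left_id dual_one dual_mul.
Proof. by move=> g; apply: dual_ext => x /=; rewrite mul1r. Qed.

Lemma dual_mulg1 : right_id dual_one dual_mul.
Proof. by move=> g; apply: dual_ext => x /=; rewrite mulr1. Qed.

Lemma dual_mulVg : left_inverse dual_one dual_inv dual_mul.
Proof.
by move=> g; apply: dual_ext => x /=; rewrite mulVf// dual_fun_neq0.
Qed.

Lemma dual_mulgV : right_inverse dual_one dual_inv dual_mul.
Proof.
by move=> g; apply: dual_ext => x /=; rewrite mulfV// dual_fun_neq0.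
Qed.

HB.instance Definition _ := isGroup.Build (dual R G)
  dual_mulA dual_mul1g dual_mulg1 dual_mulVg dual_mulgV.

HB.instance Definition _ := isPointed.Build (dual R G) dual_one.

(* The compact-open topology, which for discrete G is the topology of
   pointwise convergence. The regular algebra R[i]^o is R[i] with the topology
   of its norm. *)
HB.instance Definition _ := Topological.copy (dual R G)
  (initial_topology (fun g : dual R G => (g : {ptws G -> R[i]^o}))).

HB.instance Definition _ := Measurable.copy (dual R G)
  (g_sigma_algebraType (@open (dual R G))).

End dual_structures.

Section trigonometric_approximation.
Variables (R : realType) (G : zmodType).
Local Notation Gamma := (dual R G).

Definition char_of (x : G) (g : Gamma) : R[i] := g x.

Definition regular_measure (mu : {measure set Gamma -> \bar R}) :=
  forall A : set Gamma, measurable A ->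
    mu A = ereal_inf [set mu U | U in [set U | open U /\ A `<=` U]] /\
    mu A = ereal_sup [set mu K | K in [set K | compact K /\ K `<=` A]].

(* Being a measure on the Borel sets, non-negative and finite is carried by the
   type {finite_measure ...}. *)
Definition nonzero_regular : set {finite_measure set Gamma -> \bar R} :=
  [set mu | regular_measure mu /\ mu setT != 0%E].

(* This determines la uniquely; normalization is la setT = 1, which is part of
   the type [probability]. *)
Definition normalized_haar (la : probability Gamma R) :=
  regular_measure la /\
  forall (g : Gamma) (A : set Gamma), measurable A ->
    la [set (g * h)%g | h in A] = la A.

Definition trig_poly (S : set G) : set (Gamma -> R[i]) :=
  [set tau | exists (n : nat) (a : 'I_n -> R[i]) (x : 'I_n -> G),
    (forall j, S (x j)) /\
    tau = fun g => \sum_(j < n) a j * char_of (x j) g].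

Definition approx_dist (p : R) (mu : {finite_measure set Gamma -> \bar R})
    (S : set G) : \bar R :=
  ereal_inf [set (\int[mu]_g ((ComplexField.Normc.normc (1 - tau g)) `^ p)%:E)%E
            | tau in trig_poly S].

Definition cvg_in_measure (nu : {measure set Gamma -> \bar R})
    (f : nat -> Gamma -> \bar R) (f0 : Gamma -> \bar R) :=
  forall eps : R, 0 < eps ->
    nu [set g | (eps%:E <= `|f n g - f0 g|)%E] @[n --> \oo] --> 0%E.

Definition m_lim (mu : nat -> {finite_measure set Gamma -> \bar R})
    (mu0 : {finite_measure set Gamma -> \bar R}) :=
  exists nu : {finite_measure set Gamma -> \bar R},
    [/\ nonzero_regular nu,
        mu0 `<< nu,
        (forall n, mu n `<< nu) &
        cvg_in_measure nu
          (fun n => 'd (charge_of_finite_measure (mu n)) '/d nu)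
          ('d (charge_of_finite_measure mu0) '/d nu)].

End trigonometric_approximation.

(* Main.v *)
Require Import Defs.
From HB Require Import structures.
From mathcomp Require Import all_boot all_order all_algebra.
From mathcomp Require Import all_classical all_reals all_analysis.
From mathcomp Require Import measurable_realfun complex ring lra.

Set Implicit Arguments.
Unset Strict Implicit.
Unset Printing Implicit Defensive.

Import Order.TTheory GRing.Theory Num.Theory.
Import numFieldNormedType.Exports.
Import ComplexField.Normc.

Local Open Scope classical_set_scope.
Local Open Scope ring_scope.

(** The hypothesis on [mu0] provides a trigonometric polynomial [f = 1 - tau],
    with constant term 1 and frequencies of [tau] different from 0, such that the
    integral of [|f|^p] for [mu0] is small. It cannot be reused directly for
    [mu n], since convergence in measure says nothing about the mass that [mu n]
    carries on the set [D] where its density is far from that of [mu0]. But, up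
    to a part that is null for [mu n], the set [D] has small Haar measure [la],
    so [f] can be cut off there: replacing
    [f] by [f * 1_A], where [A] is essentially the complement of [D], changes the
    constant term by little, and makes the [p]-th moment for [mu n] comparable
    to that of [f] for [mu0]. Dividing by the constant term gives a competitor
    for [mu n], so the distances tend to 0.

    Making this rigorous needs three things. First, [f * 1_A] has to be replaced
    by a trigonometric polynomial [f * Q]. By regularity it is enough that [Q]
    takes values in [0, 1], is close to 1 on a given compact set and close to 0
    off a given open set around it ([trig_urysohn]). Second, the constant term of
    a trigonometric polynomial must be controlled by its [L^1] norm for [la]
    ([constant_term_ge]); this is the vanishing of the Haar integral of a
    nontrivial character ([haar_char0]). Should some nonzero [x] be sent to 1 by
    every character, then all distances are 0 ([approx_dist_trivial_char]), so
    such [x] can be excluded. The two ingredients are combined in [approx_dist_cut].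
    Third, convergence in measure is stated for some [nu] dominating the [mu n],
    and [la] need not be absolutely continuous with respect to [nu]; yet a set of
    small [nu]-measure has small [la]-measure up to a [nu]-null subset
    ([small_modulo_null]), and such a subset does not matter for [mu n]. *)

(** * The algebra of trigonometric polynomials *)

Section trig_algebra.
Local Open Scope complex_scope.
Variables (R : realType) (G : zmodType).
Local Notation Gamma := (dual R G).
Implicit Types (S : set G) (t u : Gamma -> R[i]).

(** The indexing by ordinals is awkward for concatenation and products; all
    closure properties are read off this presentation by lists of pairs
    (coefficient, frequency). *)
Lemma trig_polyP S t : trig_poly S t <->
  exists2 s : seq (R[i] * G), (forall y, y \in s -> S y.2) &
    t = fun g => \sum_(y <- s) y.1 * g y.2.
Proof.
split=> [[n [a [x [Sx ->]]]]|[s Ss ->]].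
  exists [seq (a j, x j) | j <- enum 'I_n].
    by move=> _ /mapP[j _ ->]; exact: Sx.
  by apply/funext => g; rewrite big_map big_enum.
exists (size s), (fun j => (tnth (in_tuple s) j).1),
  (fun j => (tnth (in_tuple s) j).2); split=> [j|].
  by apply: Ss; exact: mem_tnth.
by apply/funext => g; rewrite big_tnth.
Qed.

Lemma trig_polyD S t u :
  trig_poly S t -> trig_poly S u -> trig_poly S (fun g => t g + u g).
Proof.
move=> /trig_polyP[s Ss ->] /trig_polyP[r Sr ->]; apply/trig_polyP.
exists (s ++ r); last by apply/funext => g; rewrite big_cat.
by move=> y; rewrite mem_cat => /orP[/Ss|/Sr].
Qed.

Lemma trig_polyZ S (c : R[i]) t :
  trig_poly S t -> trig_poly S (fun g => c * t g).
Proof.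
move=> /trig_polyP[s Ss ->]; apply/trig_polyP.
exists [seq (c * y.1, y.2) | y <- s]; first by move=> _ /mapP[y /Ss Sy ->].
apply/funext => g; rewrite big_map mulr_sumr.
by apply: eq_bigr => y _; rewrite mulrA.
Qed.

Lemma trig_poly_char S (x : G) : S x -> trig_poly S (fun g : Gamma => g x).
Proof.
move=> Sx; apply/trig_polyP; exists [:: (1, x)].
  by move=> y; rewrite inE => /eqP ->.
by apply/funext => g; rewrite big_seq1 mul1r.
Qed.

Lemma dual_fun0 (g : Gamma) : g 0 = 1.
Proof.
apply: (mulfI (dual_fun_neq0 g 0)).
by rewrite -dual_funD addr0 mulr1.
Qed.

Lemma trig_poly_cst (c : R[i]) : trig_poly setT (fun _ : Gamma => c).
Proof.
have := trig_polyZ c (@trig_poly_char setT 0 I).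
by congr trig_poly; apply/funext => g; rewrite dual_fun0 mulr1.
Qed.

Lemma trig_polyM t u : trig_poly setT t -> trig_poly setT u ->
  trig_poly setT (fun g => t g * u g).
Proof.
move=> /trig_polyP[s _ ->] /trig_polyP[r _ ->]; apply/trig_polyP.
exists [seq (y.1 * z.1, y.2 + z.2) | y <- s, z <- r] => //.
apply/funext => g; rewrite big_allpairs_dep mulr_suml; apply: eq_bigr => y _.
rewrite mulr_sumr; apply: eq_bigr => z _ /=.
by rewrite dual_funD mulrACA.
Qed.

(** Collects the monomials of frequency 0, on which all characters are 1. *)
Lemma trig_poly_constant_term t : trig_poly setT t ->
  exists c u, trig_poly (~` [set 0]) u /\ t = fun g => c + u g.
Proof.
move=> /trig_polyP[s _ ->].
exists (\sum_(y <- s | y.2 == 0) y.1),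
  (fun g => \sum_(y <- [seq y <- s | y.2 != 0]) y.1 * g y.2); split.
  apply/trig_polyP; exists [seq y <- s | y.2 != 0] => // y.
  by rewrite mem_filter => /andP[/eqP].
apply/funext => g; rewrite (bigID (fun y => y.2 == 0))/= big_filter.
by congr (_ + _); apply: eq_bigr => y /eqP ->; rewrite dual_fun0 mulr1.
Qed.

Definition real_trig_poly (u : Gamma -> R) :=
  trig_poly setT (fun g => (u g)%:C).

Implicit Types v w : Gamma -> R.

Lemma real_trig_poly_cst (c : R) : real_trig_poly (fun=> c).
Proof. exact: trig_poly_cst. Qed.

Lemma real_trig_polyD v w : real_trig_poly v -> real_trig_poly w ->
  real_trig_poly (fun g => v g + w g).
Proof.
move=> tv tw; rewrite /real_trig_poly.
under eq_fun do rewrite rmorphD.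
exact: trig_polyD.
Qed.

Lemma real_trig_polyM v w : real_trig_poly v -> real_trig_poly w ->
  real_trig_poly (fun g => v g * w g).
Proof.
move=> tv tw; rewrite /real_trig_poly.
under eq_fun do rewrite rmorphM.
exact: trig_polyM.
Qed.

Lemma real_trig_polyB v w : real_trig_poly v -> real_trig_poly w ->
  real_trig_poly (fun g => v g - w g).
Proof.
move=> tv tw; under eq_fun do rewrite -mulN1r.
by apply/real_trig_polyD => //; apply/real_trig_polyM/tw/real_trig_poly_cst.
Qed.

Lemma real_trig_polyX v n :
  real_trig_poly v -> real_trig_poly (fun g => v g ^+ n).
Proof.
move=> tv; elim: n => [|n IH]; first exact: real_trig_poly_cst.
by under eq_fun do rewrite exprS; exact: real_trig_polyM.
Qed.

Lemma real_trig_poly_prod (I : Type) (s : seq I) (v_ : I -> Gamma -> R) :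
  (forall i, real_trig_poly (v_ i)) ->
  real_trig_poly (fun g => \prod_(i <- s) v_ i g).
Proof.
move=> tv; elim: s => [|i s IH].
  by under eq_fun do rewrite big_nil; exact: real_trig_poly_cst.
by under eq_fun do rewrite big_cons; exact: real_trig_polyM.
Qed.

Lemma real_trig_poly_sum (I : Type) (s : seq I) (v_ : I -> Gamma -> R) :
  (forall i, real_trig_poly (v_ i)) ->
  real_trig_poly (fun g => \sum_(i <- s) v_ i g).
Proof.
move=> tv; elim: s => [|i s IH].
  by under eq_fun do rewrite big_nil; exact: real_trig_poly_cst.
by under eq_fun do rewrite big_cons; exact: real_trig_polyD.
Qed.

Lemma normr_normc (z : R[i]) : `|z| = (normc z)%:C.
Proof. by case: z. Qed.

Lemma normc_dual (g : Gamma) x : normc (g x) = 1.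
Proof. by apply: (@complexI R); rewrite -normr_normc dual_fun_norm. Qed.

Lemma normc_ge0 (z : R[i]) : 0 <= normc z.
Proof. by case: z => a b; exact: sqrtr_ge0. Qed.

Lemma Re_le_normc (z : R[i]) : `|complex.Re z| <= normc z.
Proof. by rewrite -lecR -normr_normc; exact: normc_ge_Re. Qed.

(** Expanding the square leaves only the frequencies 0, [x] and [- x], since
    the conjugate of [h x] is [h (- x)]. *)
Lemma real_trig_poly_dist2 (x : G) (z : R[i]) :
  real_trig_poly (fun h => normc (h x - z) ^+ 2).
Proof.
rewrite /real_trig_poly.
have -> : (fun h : Gamma => (normc (h x - z) ^+ 2)%:C) =
    fun h : Gamma => (1 + z * z^*%C) + ((- z^*%C) * h x + (- z) * h (- x)).
  apply/funext => h.
  have hC : (h x)^*%C = h (- x).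
    apply: (mulfI (dual_fun_neq0 h x)).
    by rewrite -dual_funD subrr dual_fun0 -sqr_normc dual_fun_norm expr1n.
  have hh : h x * h (- x) = 1 by rewrite -dual_funD subrr dual_fun0.
  rewrite rmorphXn/= -normr_normc sqr_normc rmorphB/= hC.
  rewrite mulrBl !mulrBr hh !opprB !mulNr.
  rewrite [h x * _]mulrC; ring.
apply: trig_polyD; first exact: trig_poly_cst.
by apply: trig_polyD; apply: trig_polyZ; exact: trig_poly_char.
Qed.

End trig_algebra.

(** * Topology and Borel structure of the dual group *)

Section dual_topology.
Local Open Scope complex_scope.
Variables (R : realType) (G : zmodType).
Local Notation Gamma := (dual R G).

Definition dual_nbhs (g : Gamma) (s : seq G) (d : R) :=
  [set h : Gamma | forall x, x \in s -> normc (h x - g x) < d].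

Lemma dual_nbhs_filter (g : Gamma) :
  Filter [set A | exists s d, 0 < d /\ dual_nbhs g s d `<=` A].
Proof.
split; first by exists [::], 1.
  move=> A B [s [d [d0 sA]]] [r [e [e0 rB]]].
  exists (s ++ r), (Num.min d e); split; first by rewrite lt_min d0.
  move=> h hm; split; [apply: sA|apply: rB] => x xs.
    by have := hm x; rewrite mem_cat xs => /(_ isT); rewrite lt_min => /andP[].
  by have := hm x; rewrite mem_cat xs orbT => /(_ isT); rewrite lt_min => /andP[].
by move=> A B AB [s [d [d0 sA]]]; exists s, d; split => //; exact: subset_trans AB.
Qed.

Lemma char_continuous (x : G) : continuous (fun g : Gamma => (g x : R[i]^o)).
Proof.
move=> g.
apply: (@continuous_comp _ _ _
  (fun h : Gamma => (h : {ptws G -> R[i]^o})) (fun f => f x)).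
  exact: initial_continuous.
exact: (@proj_continuous G (fun=> R[i]^o) x).
Qed.

(** The concrete form of the topology of pointwise convergence: characters that
    are close to [g] at finitely many points form a base of neighbourhoods. *)
Lemma nbhs_dualP (g : Gamma) (A : set Gamma) :
  nbhs g A <-> exists s d, 0 < d /\ dual_nbhs g s d `<=` A.
Proof.
split; last first.
  move=> [s [d [d0 sA]]]; apply: filterS sA _.
  elim: s => [|x s IH]; first by apply: filterS filterT => h _ x.
  have /cvgrPdist_lt/(_ d%:C) := @char_continuous x g.
  rewrite ltcR => /(_ d0) => nx.
  move: nx IH; apply: filterS2 => h /= hx hs y; rewrite inE => /orP[/eqP ->|/hs//].
  by rewrite -ltcR -normr_normc distrC.
pose F : set_system Gamma := [set A | exists s d, 0 < d /\ dual_nbhs g s d `<=` A].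
have FF : Filter F := dual_nbhs_filter g.
suff Fg : {ptws, (fun h : Gamma => (h : G -> R[i]^o)) @ F --> (g : G -> R[i]^o)}.
  move=> [/= _ [[W oW <-] Wg WA]].
  have : F ((fun h : Gamma => (h : {ptws G -> R[i]^o})) @^-1` W).
    by apply: Fg; exact: open_nbhs_nbhs.
  by apply: filterS.
apply/cvg_sup => x A' [/= _ [[V oV <-] Vg VA']].
have /nbhs_ballP[e /= e0 eV] : nbhs (g x : R[i]^o) V by exact: open_nbhs_nbhs.
exists [:: x], (complex.Re e); split; first by move: e0; rewrite ltcE => /andP[].
move=> h /(_ x); rewrite inE eqxx => /(_ isT) /= hx.
apply/VA'/eV; rewrite -ball_normE/= distrC normr_normc.
by rewrite -(RRe_real (gtr0_real e0)) ltcR.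
Qed.

Lemma dual_mul_continuous (g : Gamma) : continuous (fun h : Gamma => (g * h)%g).
Proof.
move=> h A /nbhs_dualP[s [d [d0 sA]]]; apply/nbhs_dualP.
exists s, d; split=> // k kh; apply: sA => x /kh.
by rewrite /= -mulrBr normcM normc_dual mul1r.
Qed.

Lemma dual_continuous_measurable (u : Gamma -> R) :
  continuous u -> measurable_fun setT u.
Proof.
move=> /continuousP cu.
apply: (measurability _ (RGenOpens.measurableE R)).
move=> _ [_ [a [b ->]] <-]; rewrite setTI.
by apply: sub_sigma_algebra; exact/cu/interval_open.
Qed.

Lemma Re_char_continuous (a : R[i]) (x : G) :
  continuous (fun g : Gamma => complex.Re (a * g x) : R).
Proof.
move=> g; have FF : Filter (nbhs g) := nbhs_filter g.
apply/(@cvgrPdist_lt _ _ _ _ FF) => e e0; apply/nbhs_dualP.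
have n1 : 0 < normc a + 1 by rewrite ltr_wpDl// normc_ge0.
exists [:: x], (e / (normc a + 1)); split; first by rewrite divr_gt0.
move=> h /(_ x); rewrite inE eqxx => /(_ isT) hx /=.
rewrite -raddfB -mulrBr; apply: le_lt_trans (Re_le_normc _) _.
rewrite normcM -opprB normcN.
rewrite ltr_pdivlMr// mulrC in hx; apply: le_lt_trans hx.
by rewrite ler_wpM2r ?normc_ge0// lerDl.
Qed.

Lemma trig_poly_Re_continuous S (t : Gamma -> R[i]) :
  trig_poly S t -> continuous (fun g => complex.Re (t g) : R).
Proof.
move=> /trig_polyP[s _ ->]; elim: s => [|y s IH].
  by under eq_fun do rewrite big_nil; exact: cst_continuous.
under eq_fun do rewrite big_cons raddfD.
by move=> g; apply: continuousD; [exact: Re_char_continuous|exact: IH].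
Qed.

Lemma real_trig_poly_continuous (u : Gamma -> R) :
  real_trig_poly u -> continuous u.
Proof. by move=> /trig_poly_Re_continuous. Qed.

Lemma trig_poly_normc_measurable S (t : Gamma -> R[i]) :
  trig_poly S t -> measurable_fun setT (fun g => normc (t g) : R).
Proof.
move=> tt.
have -> : (fun g => normc (t g)) = (fun g => Num.sqrt (complex.Re (t g) ^+ 2 +
   complex.Re ((- 'i) * t g) ^+ 2)).
  apply/funext => g; case: (t g) => a b /=; congr Num.sqrt; congr (_ + _ ^+ 2).
  by ring.
apply: measurableT_comp.
  by apply: continuous_measurable_fun; exact: sqrt_continuous.
by apply: measurable_funD; apply: measurable_funX;
  apply: dual_continuous_measurable; apply: (@trig_poly_Re_continuous S) => //;
  exact: trig_polyZ.
Qed.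

Lemma trig_poly_bounded S (t : Gamma -> R[i]) :
  trig_poly S t -> exists B, forall g, normc (t g) <= B.
Proof.
move=> /trig_polyP[s _ ->]; exists (\sum_(y <- s) normc y.1) => g.
elim: s => [|y s IH]; first by rewrite !big_nil normc0.
rewrite !big_cons; apply: le_trans (le_normcD _ _) _.
by rewrite lerD// normcM normc_dual mulr1.
Qed.

End dual_topology.

(** * Separation of sets by trigonometric polynomials *)

Section power_estimates.
Variable R : realFieldType.
Implicit Types (t y : R) (N k n : nat).

Lemma bernoulli_lower y N : 0 <= y <= 1 -> 1 - N%:R * y <= (1 - y) ^+ N.
Proof.
move=> /andP[y0 y1]; elim: N => [|N IH]; first by rewrite expr0 mul0r subr0.
rewrite exprS -natr1.
have : (1 - y) * (1 - N%:R * y) <= (1 - y) * (1 - y) ^+ N.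
  by rewrite ler_wpM2l// subr_ge0.
apply: le_trans; have : 0 <= N%:R * y * y by rewrite !mulr_ge0.
by move=> ?; lra.
Qed.

Lemma bernoulli_upper y N : 0 <= y <= 1 ->
  (1 - y) ^+ N * (1 + N%:R * y) <= 1.
Proof.
move=> /andP[y0 y1]; elim: N => [|N IH]; first by rewrite expr0 mul0r addr0 mul1r.
apply: le_trans IH; rewrite exprSr -natr1 -mulrA ler_wpM2l//.
  by rewrite exprn_ge0// subr_ge0.
have : 0 <= N%:R * y * y + y * y by rewrite addr_ge0// !mulr_ge0.
by move=> ?; lra.
Qed.

(** This bound and the next one make [(1 - t^n)^(k^n)] an approximate step
    function: as [n] grows it tends to 1 where [t <= 1 / (2 k)] and to 0 where
    [t >= 2 / k]. This is the polynomial step used by Brosowski and Deutsch in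
    their proof of the Stone-Weierstrass theorem. *)
Lemma steep_lower t k n : 0 <= t <= 1 -> k%:R * t <= 2^-1 ->
  1 - 2^-1 ^+ n <= (1 - t ^+ n) ^+ (k ^ n).
Proof.
move=> /andP[t0 t1] kt.
apply: le_trans (bernoulli_lower _ _); last by rewrite exprn_ge0// exprn_ile1.
by rewrite lerB// natrX -exprMn lerXn2r// ?nnegrE ?mulr_ge0// invr_ge0.
Qed.

Lemma steep_upper t k n : 0 <= t <= 1 -> 2 <= k%:R * t ->
  (1 - t ^+ n) ^+ (k ^ n) <= 2^-1 ^+ n.
Proof.
move=> /andP[t0 t1] kt.
have tn : 0 <= t ^+ n <= 1 by rewrite exprn_ge0// exprn_ile1.
have := bernoulli_upper (k ^ n) tn; rewrite natrX -exprMn => h.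
have k2 : 2 ^+ n <= (k%:R * t) ^+ n by rewrite lerXn2r// nnegrE ?mulr_ge0.
rewrite exprVn -[leRHS]mul1r ler_pdivlMr ?exprn_gt0//; apply: le_trans h.
rewrite ler_wpM2l ?exprn_ge0 ?subr_ge0//; first by case/andP: tn.
by rewrite (le_trans k2)// lerDr.
Qed.

Lemma prod_compl_itv (I : Type) (s : seq I) (q : I -> R) :
  (forall i, 0 <= q i <= 1) -> 0 <= \prod_(i <- s) (1 - q i) <= 1.
Proof.
move=> q01; apply/andP; split.
  by apply: prodr_ge0 => i _; rewrite subr_ge0; case/andP: (q01 i).
elim: s => [|i s IH]; rewrite ?big_nil// big_cons.
have /andP[qi0 qi1] := q01 i.
rewrite mulr_ile1 ?subr_ge0 ?gerBl//.
by apply: prodr_ge0 => j _; rewrite subr_ge0; case/andP: (q01 j).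
Qed.

Lemma prod_compl_le (I : eqType) (s : seq I) (q : I -> R) i :
  (forall i, 0 <= q i <= 1) -> i \in s -> \prod_(i <- s) (1 - q i) <= 1 - q i.
Proof.
move=> q01; elim: s => // j s IH; rewrite inE big_cons.
have /andP[p0 p1] := prod_compl_itv s q01.
have /andP[qj0 qj1] := q01 j.
move=> /orP[/eqP ->|/IH h]; first by rewrite ler_piMr// subr_ge0.
by apply: le_trans h; rewrite ler_piMl// gerBl.
Qed.

Lemma prod_compl_ge (I : Type) (s : seq I) (q : I -> R) e :
  (forall i, 0 <= q i <= 1) -> (forall i, q i <= e) ->
  1 - (size s)%:R * e <= \prod_(i <- s) (1 - q i).
Proof.
move=> q01 qe; elim: s => [|j s IH]; first by rewrite big_nil mul0r subr0.
rewrite big_cons/= -natr1 mulrDl mul1r.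
have /andP[p0 p1] := prod_compl_itv s q01.
have /andP[qj0 qj1] := q01 j; have := qe j.
set P := \prod_(i <- s) _ in IH p0 p1 *.
have : q j * P <= q j by rewrite ler_piMr.
by move=> ? ?; lra.
Qed.

End power_estimates.

Section trig_urysohn.
Local Open Scope complex_scope.
Variables (R : realType) (G : zmodType).
Local Notation Gamma := (dual R G).

(** A basic neighbourhood of [g] inside [U] is cut out by finitely many
    conditions [|h x - g x| < d]. Hence [u h], the sum of the [|h x - g x|^2], is
    a real trigonometric polynomial that vanishes at [g] and is at least [d^2]
    off [U]; the steep polynomials applied to a multiple of [u] do the rest. *)
Lemma trig_bump (U : set Gamma) (g : Gamma) : open U -> U g ->
  exists (V : set Gamma) (q : nat -> Gamma -> R),
  [/\ open V, V g & forall n, [/\ real_trig_poly (q n),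
     forall h, 0 <= q n h <= 1,
     forall h, V h -> 1 - 2^-1 ^+ n <= q n h &
     forall h, ~ U h -> q n h <= 2^-1 ^+ n]].
Proof.
move=> oU Ug; have /nbhs_dualP[s [d [d0 sU]]] := open_nbhs_nbhs (conj oU Ug).
pose u (h : Gamma) := \sum_(x <- s) normc (h x - g x) ^+ 2.
have tu : real_trig_poly u.
  by apply: real_trig_poly_sum => x; exact: real_trig_poly_dist2.
have u0 h : 0 <= u h by apply: sumr_ge0 => x _; rewrite exprn_ge0// normc_ge0.
(* Each |h x - g x| is at most 2; the 1 only keeps c positive when s is empty. *)
pose c : R := \sum_(x <- s) 2 ^+ 2 + 1.
have c0 : 0 < c by rewrite ltr_wpDl// sumr_ge0// => x _; rewrite exprn_ge0.
have uc h : u h <= c.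
  rewrite /c; apply: (@le_trans _ _ (\sum_(x <- s) 2 ^+ 2)); last by rewrite lerDl.
  rewrite /u; apply: ler_sum => x _.
  have : normc (h x - g x) <= 2.
    by apply: le_trans (le_normcD _ _) _; rewrite normcN !normc_dual.
  by move=> h2; rewrite lerXn2r// nnegrE ?normc_ge0.
have uU h : ~ U h -> d ^+ 2 <= u h.
  move=> nU; rewrite leNgt; apply/negP => ud; apply: nU; apply: sU => x xs.
  rewrite ltNge; apply/negP => dx; move: ud; rewrite ltNge => /negP; apply.
  apply: (@le_trans _ _ (normc (h x - g x) ^+ 2)).
    by rewrite lerXn2r// nnegrE ?normc_ge0// ltW.
  rewrite /u (big_rem x)//= lerDl.
  by apply: sumr_ge0 => y _; rewrite exprn_ge0// normc_ge0.
(* The integer k is chosen so that t = u / c is at least 2 / k off U. *)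
pose k := (Num.bound (2 * c / d ^+ 2)).+1.
have k2 : 2 * c <= k%:R * d ^+ 2.
  rewrite -ler_pdivrMr ?exprn_gt0//; apply: ltW.
  have /archi_boundP : 0 <= 2 * c / d ^+ 2.
    by rewrite divr_ge0// ?mulr_ge0// ?ltW// exprn_gt0.
  by move/lt_le_trans; apply; rewrite ler_nat.
have t01 h : 0 <= u h / c <= 1.
  by rewrite divr_ge0 ?(ltW c0)//= ler_pdivrMr// mul1r.
exists [set h | k%:R * (u h / c) < 2^-1],
  (fun n h => (1 - (u h / c) ^+ n) ^+ (k ^ n)); split.
- have -> : [set h | k%:R * (u h / c) < 2^-1] = u @^-1` [set r | r < c / (2 * k%:R)].
    apply/seteqP; split=> h /=; rewrite ltr_pdivlMr ?mulr_gt0//.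
      rewrite mulrA ltr_pdivrMr// => ?; lra.
    move=> ?; rewrite mulrA ltr_pdivrMr//; lra.
  by apply: open_comp; [move=> h _; exact: real_trig_poly_continuous|exact: open_lt].
- by rewrite /= /u big1 ?mul0r ?mulr0// => x _; rewrite subrr normc0 expr0n.
move=> n; split.
- apply: real_trig_polyX; apply: real_trig_polyB; first exact: real_trig_poly_cst.
  by apply: real_trig_polyX; apply: real_trig_polyM => //; exact: real_trig_poly_cst.
- move=> h; have /andP[t0 t1] := t01 h.
  have y0 : 0 <= 1 - (u h / c) ^+ n by rewrite subr_ge0 exprn_ile1.
  by rewrite exprn_ge0//= exprn_ile1// gerBl exprn_ge0.
- by move=> h /= /ltW; exact: steep_lower.
- move=> h /uU du; apply: steep_upper => //.
  rewrite mulrA ler_pdivlMr//; apply: le_trans k2 _.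
  by rewrite ler_wpM2l.
Qed.

(** Finitely many bumps [q i] cover [K], and [1 - \prod_i (1 - q i)] is close to
    1 as soon as one bump is, and close to 0 where all of them are. *)
Lemma trig_urysohn (K U : set Gamma) (e : R) :
  compact K -> open U -> K `<=` U -> 0 < e ->
  exists Q : Gamma -> R, [/\ real_trig_poly Q, forall h, 0 <= Q h <= 1,
    forall h, K h -> 1 - e <= Q h & forall h, ~ U h -> Q h <= e].
Proof.
move=> cK oU KU e0.
pose good (W : set Gamma) q := open W /\ forall n, [/\ real_trig_poly (q n),
  forall h, 0 <= q n h <= 1,
  forall h, W h -> 1 - 2^-1 ^+ n <= q n h &
  forall h, ~ U h -> q n h <= (2^-1 ^+ n : R)].
have half0 n : 0 <= 2^-1 ^+ n :> R by rewrite exprn_ge0// invr_ge0.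
have /choice[Vq VqP] : forall g, exists Wq : set Gamma * (nat -> Gamma -> R),
    good Wq.1 Wq.2 /\ (K g -> Wq.1 g).
  move=> g.
  have [Kg|nK] := pselect (K g).
    by have [W [q [oW Wg Wq]]] := trig_bump oU (KU _ Kg); exists (W, q).
  exists (set0, fun _ _ => 0); split=> //; split; first exact: open0.
  by move=> n; split=> //= [|h]; [exact: real_trig_poly_cst|rewrite lexx ler01].
have := cK; rewrite compact_cover => /(_ Gamma K (fun g => (Vq g).1)) [||D DK KD].
- by move=> g _; case: (VqP g) => -[].
- by move=> g Kg; exists g => //; case: (VqP g) => _; exact.
pose r : seq Gamma := finmap.enum_fset D.
have [n /andP[n1 n2]] : exists n, (2^-1 ^+ n <= e) && ((size r)%:R * 2^-1 ^+ n <= e).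
  have /(_ e e0) : forall d : R, 0 < d -> exists n, ((size r).+1)%:R * 2^-1 ^+ n <= d.
    move=> d d0; exists (Num.bound ((size r).+1%:R / d)).
    rewrite exprVn ler_pdivrMr ?exprn_gt0// mulrC -ler_pdivrMr//.
    have /archi_boundP : 0 <= (size r).+1%:R / d by rewrite divr_ge0// ltW.
    move/ltW/le_trans; apply; rewrite -natrX ler_nat ltnW// ltn_expl//.
  move=> [n]; rewrite -natr1 mulrDl mul1r => h; exists n.
  have : 0 <= (size r)%:R * 2^-1 ^+ n :> R by rewrite mulr_ge0.
  by have := half0 n; move=> ? ?; apply/andP; split; lra.
have qP g : [/\ real_trig_poly ((Vq g).2 n), forall h, 0 <= (Vq g).2 n h <= 1,
    forall h, (Vq g).1 h -> 1 - 2^-1 ^+ n <= (Vq g).2 n h &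
    forall h, ~ U h -> (Vq g).2 n h <= 2^-1 ^+ n].
  by case: (VqP g) => -[_ /(_ n)].
pose q g := (Vq g).2 n.
have q01 h g : 0 <= q g h <= 1 by have [_ /(_ h)] := qP g.
exists (fun h => 1 - \prod_(g <- r) (1 - q g h)); split.
- apply: real_trig_polyB; first exact: real_trig_poly_cst.
  apply: real_trig_poly_prod => g.
  by apply: real_trig_polyB; [exact: real_trig_poly_cst|case: (qP g)].
- move=> h; have /andP[p0 p1] := prod_compl_itv r (q01 h).
  by rewrite subr_ge0 p1 gerBl.
- move=> h Kh; have [g gD Vh] := KD h Kh.
  have := prod_compl_le (q01 h) gD; rewrite lerBlDr.
  by case: (qP g) => _ _ /(_ h Vh) + _; rewrite -/(q g) => ? ?; lra.
- move=> h nU; have := @prod_compl_ge _ _ r (q^~ h) (2^-1 ^+ n) (q01 h).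
  have qe g : q g h <= 2^-1 ^+ n by case: (qP g) => _ _ _; exact.
  by move=> /(_ qe) ?; lra.
Qed.
End trig_urysohn.

(** * Haar integrals of trigonometric polynomials *)

Section haar.
Local Open Scope complex_scope.
Variables (R : realType) (G : zmodType).
Local Notation Gamma := (dual R G).

Lemma trig_poly_integrable S (mu : {finite_measure set Gamma -> \bar R})
    (t : Gamma -> R[i]) : trig_poly S t ->
  mu.-integrable setT (fun h => (complex.Re (t h))%:E) /\
  mu.-integrable setT (fun h => (normc (t h))%:E).
Proof.
move=> tt; have [B tB] := trig_poly_bounded tt.
have muT : (mu setT < +oo)%E by rewrite ltey_eq fin_num_measure.
split; apply: measurable_bounded_integrable => //.
- by apply: dual_continuous_measurable; exact: trig_poly_Re_continuous tt.
- exists B; split; first exact: num_real.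
  move=> M BM h _ /=; apply: le_trans (Re_le_normc _) _.
  exact: le_trans (tB h) (ltW BM).
- exact: trig_poly_normc_measurable tt.
- exists B; split; first exact: num_real.
  move=> M BM h _ /=; rewrite ger0_norm ?normc_ge0//.
  exact: le_trans (tB h) (ltW BM).
Qed.

Variables (la : probability Gamma R) (la_haar : normalized_haar la).

Lemma haar_integral_translate (g : Gamma) (f : Gamma -> \bar R) :
  measurable_fun setT f -> la.-integrable setT f ->
  la.-integrable setT (f \o (fun h => (g * h)%g)) ->
  (\int[la]_h f (g * h)%g = \int[la]_h f h)%E.
Proof.
move=> mf intf intgf.
have mg : measurable_fun setT (fun h : Gamma => (g * h)%g).
  apply: (measurability _ (erefl : @measurable _ Gamma = <<s @open Gamma >>)).
  move=> _ [A oA <-]; rewrite setTI; apply: sub_sigma_algebra.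
  by move: A oA; apply/continuousP; exact: dual_mul_continuous.
rewrite -[LHS]/(\int[la]_(h in (fun h => (g * h)%g) @^-1` setT)
   (f \o (fun h => (g * h)%g)) h)%E -integral_pushforward//.
apply: eq_measure_integral => A mA _; rewrite /pushforward.
have mgA : measurable ((fun h : Gamma => (g * h)%g) @^-1` A).
  by rewrite -[X in measurable X]setTI; exact: mg.
transitivity (la [set (g * h)%g | h in (fun h : Gamma => (g * h)%g) @^-1` A]).
  by rewrite (la_haar.2 g _ mgA).
congr (la _); apply/seteqP; split=> [h [k Ak <-]//|h Ah].
by exists (g^-1 * h)%g; rewrite /= mulgA mulgV mul1g.
Qed.

(** Real parts are used to stay with real integrals. Writing [F a] for the
    integral of [Re (a * h x)], translation by [g] gives [F (a * g x) = F a], and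
    [F] is additive; every [a] is of the form [b - b * g x] because
    [g x != 1]. *)
Lemma haar_char0 (x : G) (a : R[i]) : (exists g : Gamma, g x != 1) ->
  (\int[la]_h (complex.Re (a * h x))%:E = 0)%E.
Proof.
move=> [g gx].
have tx b : trig_poly [set x] (fun h : Gamma => b * h x).
  by apply: trig_polyZ; exact: trig_poly_char.
have int_ b := (trig_poly_integrable la (tx b)).1.
have inv b : (\int[la]_h (complex.Re (b * h x))%:E =
              \int[la]_h (complex.Re ((b * g x) * h x))%:E)%E.
  rewrite -(@haar_integral_translate g (fun h => (complex.Re (b * h x))%:E))//.
  - by apply: eq_integral => h _ /=; rewrite mulrA.
  - exact: measurable_int (int_ b).
  - rewrite (_ : _ \o _ = (fun h : Gamma => (complex.Re ((b * g x) * h x))%:E))//.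
    by apply/funext => h /=; rewrite mulrA.
have gx1 : 1 - g x != 0 by rewrite subr_eq0 eq_sym.
rewrite -[a](divfK gx1).
set b := a / _.
under eq_integral do rewrite mulrBr mulr1 mulrBl raddfB EFinB.
rewrite integralB//= -inv subee//.
exact: integrable_fin_num.
Qed.

Hypothesis separates : forall x : G, x <> 0 -> exists g : Gamma, g x != 1.

Lemma haar_constant_term (c : R[i]) (t : Gamma -> R[i]) :
  trig_poly (~` [set 0]) t ->
  (\int[la]_h (complex.Re (c + t h))%:E = (complex.Re c)%:E)%E.
Proof.
move=> tt.
under eq_integral do rewrite raddfD EFinD.
rewrite integralD//; last 2 first.
- exact: (trig_poly_integrable la (trig_poly_cst G c)).1.
- exact: (trig_poly_integrable la tt).1.
rewrite integral_cst// [X in (_ * X)%E](_ : _ = 1%E); last first.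
  exact: probability_setT.
rewrite mule1.
suff -> : (\int[la]_h (complex.Re (t h))%:E = 0)%E by rewrite adde0.
move: tt => /trig_polyP[s Ss ->].
elim: s Ss => [|y s IH] Ss.
  by under eq_integral do rewrite big_nil; rewrite integral0.
under eq_integral do rewrite big_cons raddfD EFinD.
have ts : trig_poly setT (fun g : Gamma => \sum_(z <- s) z.1 * g z.2).
  by apply/trig_polyP; exists s.
have ty : trig_poly setT (fun g : Gamma => y.1 * g y.2).
  by apply: trig_polyZ; exact: trig_poly_char.
rewrite integralD//; last 2 first.
- exact: (trig_poly_integrable la ty).1.
- exact: (trig_poly_integrable la ts).1.
rewrite haar_char0; last by apply: separates; apply: Ss; rewrite mem_head.
by rewrite add0e IH// => z zs; apply: Ss; rewrite inE zs orbT.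
Qed.

Lemma constant_term_ge (c : R[i]) (t : Gamma -> R[i]) :
  trig_poly (~` [set 0]) t ->
  ((complex.Re c)%:E <= \int[la]_h (normc (c + t h))%:E)%E.
Proof.
move=> tt; rewrite -(haar_constant_term c tt).
have tct : trig_poly setT (fun h => c + t h).
  apply: trig_polyD; first exact: trig_poly_cst.
  by move: tt => /trig_polyP[s _ ->]; apply/trig_polyP; exists s.
have [i1 i2] := trig_poly_integrable la tct.
apply: le_integral => // h _.
by rewrite lee_fin; apply: le_trans (Re_le_normc _); exact: ler_norm.
Qed.
End haar.

(** * Densities that are close outside a small set *)

Section measure_lemmas.
Context d (T : measurableType d) (R : realType).
Local Open Scope ereal_scope.
Local Open Scope charge_scope.

(** A substitute for the epsilon-delta form of absolute continuity when [la] is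
    not absolutely continuous with respect to [nu]. If it failed, there would be
    sets [F n] with summable [nu]-measures admitting no such [N]. Their upper
    limit [L] is [nu]-null by Borel-Cantelli, while the tail unions of [F]
    decrease to [L], so that the [la]-measure of [F n] minus [L] tends to 0. *)
Lemma small_modulo_null (nu la : {finite_measure set T -> \bar R}) (e : R) :
  (0 < e)%R -> exists2 a : R, (0 < a)%R & forall B, measurable B ->
  nu B < a%:E -> exists N, [/\ measurable N, N `<=` B, nu N = 0 &
                               la (B `\` N) < e%:E].
Proof.
move=> e0; apply: contrapT => H.
have /choice[F FP] : forall n, exists B, [/\ measurable B,
    nu B < (1 / (2 ^ n.+1)%:R)%:E &
    forall N, measurable N -> N `<=` B -> nu N = 0 -> e%:E <= la (B `\` N)].
  move=> n; apply: contrapT => Hn; apply: H.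
  exists (1 / (2 ^ n.+1)%:R)%R; first by rewrite divr_gt0// ltr0n expn_gt0.
  move=> B mB nuB; apply: contrapT => HN; apply: Hn; exists B; split=> // N mN NB N0.
  by rewrite leNgt; apply/negP => h; apply: HN; exists N.
have mF k : measurable (F k) by case: (FP k).
have mL : measurable (lim_sup_set F).
  by apply: bigcap_measurable => // k _; exact: bigcup_measurable.
have nuL : nu (lim_sup_set F) = 0.
  apply: lim_sup_set_cvg0 => //.
  apply: (@le_lt_trans _ _ (\sum_(0 <= n <oo) (1 / (2 ^ n.+1)%:R)%:E)).
    by apply: lee_nneseries => // n _; case: (FP n) => _ /ltW.
  by apply: le_lt_trans (ltry 1); exact: epsilon_trick0.
have mU n : measurable (\bigcup_(k >= n) F k) by exact: bigcup_measurable.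
have laU n : la (lim_sup_set F) + e%:E <= la (\bigcup_(k >= n) F k).
  have [_ _ /(_ (F n `&` lim_sup_set F))] := FP n.
  move=> /(_ (measurableI _ _ (mF n) mL) (@subIsetl _ _ _)).
  have -> : nu (F n `&` lim_sup_set F) = 0.
    by apply: (subset_measure0 _ mL) nuL => //; exact: measurableI.
  rewrite setDIr setDv set0U => /(_ erefl) h.
  apply: (@le_trans _ _ (la (lim_sup_set F) + la (F n `\` lim_sup_set F))).
    by rewrite leeD2l.
  rewrite -measureU//; last 2 first.
    exact: measurableD.
    by rewrite setDE setICA setICr setI0.
  rewrite le_measure ?inE//; first by apply: measurableU => //; exact: measurableD.
  move=> x [Lx|[Fx _]]; first exact: Lx.
  by exists n => /=.
have : la (lim_sup_set F) + e%:E <= la (lim_sup_set F).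
  have laUfin : la (\bigcup_(k >= 0) F k) < +oo by rewrite ltey_eq fin_num_measure.
  have /(cvg_lim (@ereal_hausdorff _)) h := lim_sup_set_cvg la F mF laUfin.
  rewrite -[leRHS]h//.
  apply: lime_ge; last exact: nearW.
  apply: ereal_nonincreasing_is_cvgn => a b ab.
  by rewrite le_measure ?inE//; apply: bigcup_subset => n /=; exact: leq_trans.
have : la (lim_sup_set F) \is a fin_num by rewrite fin_num_measure.
by move/fineK => <-; rewrite -EFinD lee_fin gerDl leNgt e0.
Qed.

(** Both integrals are rewritten against [nu]: on [A] the density of [mu1] exceeds
    that of [mu0] by at most [a], so the integrands differ by at most [a * M]. *)
Lemma integral_le_of_density_close
    (nu mu0 mu1 : {finite_measure set T -> \bar R}) (a M : R) (h : T -> R)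
    (A : set T) :
  mu0 `<< nu -> mu1 `<< nu -> (0 <= a)%R -> measurable A ->
  (forall x, A x -> `|'d (charge_of_finite_measure mu1) '/d nu x -
                      'd (charge_of_finite_measure mu0) '/d nu x| <= a%:E) ->
  measurable_fun setT h -> (forall x, 0 <= h x <= M)%R ->
  \int[mu1]_(x in A) (h x)%:E <=
  \int[mu0]_x (h x)%:E + (a * M)%:E * nu setT.
Proof.
move=> mu0nu mu1nu a0 mA close mh h0M.
have h0 x : (0 <= h x)%R by case/andP: (h0M x).
have hM x : (h x <= M)%R by case/andP: (h0M x).
have mhA : measurable_fun A h by exact: measurable_funTS.
have bh : [bounded h x | x in A].
  exists M; split; first exact: num_real.
  by move=> N MN x _ /=; rewrite ger0_norm//; apply: le_trans (hM x) (ltW MN).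
have inth (mu : {finite_measure set T -> \bar R}) : mu.-integrable A (EFin \o h).
  by apply: measurable_bounded_integrable => //; rewrite ltey_eq fin_num_measure.
have intRN (mu : {finite_measure set T -> \bar R}) : mu `<< nu ->
    nu.-integrable A (fun x => (h x)%:E * 'd (charge_of_finite_measure mu) '/d nu x).
  move=> munu; apply: (integrableMr mA mhA bh).
  by apply: (integrableS measurableT) => //; exact: Radon_Nikodym_integrable.
rewrite -(Radon_Nikodym_change_of_variables mu1nu mA (inth mu1)).
apply: (@le_trans _ _ (\int[nu]_(x in A)
   ((h x)%:E * 'd (charge_of_finite_measure mu0) '/d nu x + a%:E * (h x)%:E))).
  apply: le_integral => //.
  - exact: intRN.
  - apply: integrableD => //; [exact: intRN|apply: integrableZl => //; exact: inth].
  - move=> x /set_mem Ax; rewrite [a%:E * _]muleC -muleDr//; last first.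
      by rewrite fin_num_adde_defl.
    rewrite lee_wpmul2l ?lee_fin// -leeBlDl ?Radon_Nikodym_fin_num//.
    exact: le_trans (lee_abs _) (close _ Ax).
rewrite integralD//; last 2 first.
- exact: intRN.
- by apply: integrableZl => //; exact: inth.
rewrite (Radon_Nikodym_change_of_variables mu0nu mA (inth mu0)).
apply: leeD.
  apply: ge0_subset_integral => //; first exact/measurable_EFinP.
  by move=> x _; rewrite lee_fin.
rewrite integralZl//; last exact: inth.
rewrite EFinM -muleA lee_wpmul2l ?lee_fin//.
have M0 : (0 <= M)%R by exact: le_trans (h0 point) (hM point).
apply: (@le_trans _ _ (\int[nu]_(x in A) M%:E)).
  apply: ge0_le_integral => //.
  - by move=> x _; rewrite lee_fin.
  - exact/measurable_EFinP.
  - by move=> x _; rewrite lee_fin.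
rewrite integral_cst// lee_wpmul2l ?lee_fin//.
by rewrite le_measure ?inE.
Qed.
End measure_lemmas.

(** * Regular measures and bounds on the distance *)

Section split_integral.
Context d (T : measurableType d) (R : realType).
Local Open Scope ereal_scope.

Lemma le_integral_split (mu : {measure set T -> \bar R}) (h F : T -> R)
    (A V : set T) (M c : R) :
  measurable A -> measurable V -> measurable_fun setT h ->
  measurable_fun setT F -> (0 <= M)%R -> (0 <= c)%R ->
  (forall x, 0 <= h x)%R -> (forall x, 0 <= F x)%R ->
  (forall x, A x -> h x <= F x)%R ->
  (forall x, ~ A x -> V x -> h x <= M)%R ->
  (forall x, ~ A x -> ~ V x -> h x <= c)%R ->
  \int[mu]_x (h x)%:E <=
    \int[mu]_(x in A) (F x)%:E + M%:E * mu V + c%:E * mu setT.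
Proof.
move=> mA mV mh mF M0 c0 h0 F0 hA hV hc.
have mFA : measurable_fun setT ((EFin \o F) \_ A).
  by apply/(measurable_restrictT _ mA); apply: measurable_funTS; exact/measurable_EFinP.
have mIV : measurable_fun setT (fun x => (M * \1_V x)%:E).
  by apply/measurable_EFinP; apply: measurable_funM => //; exact: measurable_indic.
have FA0 x : 0 <= ((EFin \o F) \_ A) x.
  by rewrite patchE; case: ifPn => // _; rewrite lee_fin.
have IV0 x : 0 <= (M * \1_V x)%:E by rewrite lee_fin mulr_ge0.
apply: (@le_trans _ _ (\int[mu]_x (((EFin \o F) \_ A) x + (M * \1_V x)%:E + c%:E))).
  apply: ge0_le_integral => //.
  - by move=> x _; rewrite lee_fin.
  - exact/measurable_EFinP.
  - by apply: emeasurable_funD => //; exact: emeasurable_funD.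
  - move=> x _; rewrite patchE indicE.
    have [xA|/negP xA] := boolP (x \in A).
      rewrite -addeA; apply: (@le_trans _ _ (F x)%:E).
        by rewrite lee_fin hA//; exact: set_mem.
      by rewrite leeDl// -EFinD lee_fin addr_ge0// mulr_ge0.
    have nAx : ~ A x by move/mem_set.
    have [xV|/negP xV] := boolP (x \in V); rewrite add0e -EFinD lee_fin.
      by rewrite mulr1 (le_trans (hV x nAx (set_mem xV))) ?lerDl.
    by rewrite mulr0 add0r hc// => /mem_set.
rewrite ge0_integralD//; last 2 first.
- by move=> x _; rewrite adde_ge0.
- exact: emeasurable_funD.
rewrite ge0_integralD// -integral_mkcond integral_cst//.
under [X in _ + X + _]eq_integral do rewrite EFinM.
rewrite ge0_integralZl//; last by apply/measurable_EFinP; exact: measurable_indic.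
by rewrite integral_indic// setIT.
Qed.
End split_integral.

Section approx_dist_bounds.
Local Open Scope complex_scope.
Variables (R : realType) (G : zmodType).
Local Notation Gamma := (dual R G).
Implicit Types (mu : {finite_measure set Gamma -> \bar R}).

(** Needed for compact sets to be Borel, hence for inner regularity to give
    measurable compact sets. *)
Lemma dual_hausdorff : hausdorff_space Gamma.
Proof.
move=> g h gh; apply: dual_ext => x; apply/eqP; rewrite -subr_eq0; apply/eqP.
apply: eq0_normc; apply/eqP; rewrite eq_le normc_ge0 andbT.
apply/ler_addgt0Pr => e e0; rewrite add0r.
have e2 : 0 < e / 2 by rewrite divr_gt0.
have ng k : nbhs k (dual_nbhs k [:: x] (e / 2)).
  by apply/nbhs_dualP; exists [:: x], (e / 2); split => // h0.
have [k [kg kh]] := gh _ _ (ng g) (ng h).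
have {}kg := kg x (mem_head _ _); have {}kh := kh x (mem_head _ _).
rewrite (_ : g x - h x = - (k x - g x) + (k x - h x)); last by ring.
by apply: le_trans (le_normcD _ _) _; rewrite normcN; lra.
Qed.

Lemma dual_open_measurable (U : set Gamma) : open U -> measurable U.
Proof. exact: sub_sigma_algebra. Qed.

Lemma dual_compact_measurable (K : set Gamma) : compact K -> measurable K.
Proof.
move=> /(compact_closed dual_hausdorff) /closed_openC /dual_open_measurable.
by move=> /measurableC; rewrite setCK.
Qed.

Lemma approx_dist_ge0 p mu S : (0 <= approx_dist p mu S)%E.
Proof.
apply: le_ereal_inf_tmp => _ [t _ <-]; apply: integral_ge0 => g _.
by rewrite lee_fin powR_ge0.
Qed.

(** Here [e_x] itself is the constant 1. This settles the situation in which the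
    characters fail to separate [x] from 0, so that separation of points of [G]
    by characters may be assumed elsewhere. *)
Lemma approx_dist_trivial_char p mu S x : 1 <= p -> S x ->
  (forall g : Gamma, g x = 1) -> approx_dist p mu S = 0%E.
Proof.
move=> p1 Sx x1; apply/eqP; rewrite eq_le approx_dist_ge0 andbT.
apply: ge_ereal_inf; exists 0%E => //.
exists (fun g => g x); first exact: trig_poly_char.
rewrite integral0_eq// => g _.
by rewrite x1 subrr normc0 powR0// gt_eqF// (lt_le_trans _ p1).
Qed.

Lemma measurable_normc_powR S (t : Gamma -> R[i]) p : trig_poly S t ->
  measurable_fun setT (fun g => normc (t g) `^ p).
Proof.
move=> tt; apply: (@measurableT_comp _ _ _ _ _ _ (@powR R ^~ p)).
  exact: measurable_powR.
exact: trig_poly_normc_measurable tt.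
Qed.

Lemma trig_poly_sub1 S (t : Gamma -> R[i]) : trig_poly S t ->
  trig_poly setT (fun g => 1 - t g).
Proof.
move=> tt; apply: trig_polyD; first exact: trig_poly_cst.
have := trig_polyZ (-1) tt; under eq_fun do rewrite mulN1r.
by move=> /trig_polyP[s _ ->]; apply/trig_polyP; exists s.
Qed.

(** Dividing by the constant term [c] turns [c + t] into an admissible
    competitor [1 - tau], with [tau = - c^-1 * t]; the factor is [|c|^-p]. *)
Lemma approx_dist_le p mu S (c : R[i]) (t : Gamma -> R[i]) :
  1 <= p -> trig_poly S t -> 2^-1 <= complex.Re c ->
  (approx_dist p mu S <=
   (2 `^ p)%:E * \int[mu]_g (normc (c + t g) `^ p)%:E)%E.
Proof.
move=> p1 tt c2.
have p0 : 0 <= p by exact: le_trans p1.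
have nc : 2^-1 <= normc c.
  exact: le_trans c2 (le_trans (ler_norm _) (Re_le_normc _)).
have c0 : c != 0.
  by apply: contraTneq nc => ->; rewrite normc0 -ltNge.
have tt' := trig_polyZ (- c^-1) tt.
have mct : measurable_fun setT (fun g => normc (c + t g) `^ p).
  have := trig_poly_sub1 (trig_polyZ (- c^-1) tt).
  move=> /(trig_polyZ c).
  under eq_fun do rewrite mulNr opprK mulrDr mulr1 mulrA divff// mul1r.
  exact: measurable_normc_powR.
apply: ge_ereal_inf; eexists; first by eexists; first exact: tt'.
rewrite -ge0_integralZl//; last 2 first.
- exact/measurable_EFinP.
- by move=> g _; rewrite lee_fin powR_ge0.
apply: ge0_le_integral => //.
- by move=> g _; rewrite lee_fin powR_ge0.
- apply/measurable_EFinP; apply: measurable_normc_powR.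
  exact: trig_poly_sub1 tt'.
- by apply/measurable_EFinP; exact: measurable_funM.
move=> g _; rewrite -EFinM lee_fin -powRM ?normc_ge0//.
apply: ge0_ler_powR; rewrite ?nnegrE ?mulr_ge0 ?normc_ge0//.
have -> : 1 - - c^-1 * t g = c^-1 * (c + t g).
  by rewrite mulNr opprK mulrDr mulVf.
rewrite normcM normcV ler_wpM2r ?normc_ge0//.
by rewrite invf_ple ?posrE// (lt_le_trans _ nc).
Qed.
End approx_dist_bounds.

Section regularity.
Variables (R : realType) (G : zmodType).
Local Notation Gamma := (dual R G).
Variable mu : {finite_measure set Gamma -> \bar R}.
Hypothesis reg : regular_measure mu.

Lemma regular_inner (A : set Gamma) (r : R) : measurable A -> 0 < r ->
  exists K, [/\ compact K, K `<=` A & (mu (A `\` K) < r%:E)%E].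
Proof.
move=> mA r0; have muA : mu A \is a fin_num by rewrite fin_num_measure.
have supE := (reg mA).2.
have [|_ [K [cK KA] <-]] := ub_ereal_sup_adherent r0 (S := [set mu K | K in
    [set K | compact K /\ K `<=` A]]).
  by rewrite -supE.
rewrite -supE => h; exists K; split => //.
have mK := dual_compact_measurable cK.
have muK : mu K \is a fin_num by rewrite fin_num_measure.
rewrite measureD// ?ltey_eq ?muA// setIidr//.
by rewrite lteBlDr// addeC -lteBlDr.
Qed.

Lemma regular_outer (A : set Gamma) (r : R) : measurable A -> 0 < r ->
  exists U, [/\ open U, A `<=` U & (mu (U `\` A) < r%:E)%E].
Proof.
move=> mA r0; have muA : mu A \is a fin_num by rewrite fin_num_measure.
have infE := (reg mA).1.
have [|_ [U [oU AU] <-]] := lb_ereal_inf_adherent r0 (S := [set mu U | U in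
    [set U | open U /\ A `<=` U]]).
  by rewrite -infE.
rewrite -infE => h; exists U; split => //.
have mU := dual_open_measurable oU.
have muU : mu U \is a fin_num by rewrite fin_num_measure.
by rewrite measureD// ?ltey_eq ?muU// setIidr// lteBlDl.
Qed.
End regularity.

(** * Cutting off a competitor *)

Section cut.
Local Open Scope complex_scope.
Variables (R : realType) (G : zmodType).
Local Notation Gamma := (dual R G).
Variables (la : probability Gamma R) (la_haar : normalized_haar la).
Hypothesis separates : forall x : G, x <> 0 -> exists g : Gamma, g x != 1.

(** Let [Q] be a trigonometric polynomial close to 1 on a compact part [K] of [A]
    and close to 0 off an open [U] containing [A]. The product [(1 - t) * Q] is a
    competitor, up to its constant term [k]: since [1 - t] has constant term 1,
    [1 - k] is the constant term of [(1 - t) * (1 - Q)], whose [la]-integral is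
    small because [1 - Q] is small outside a set of small [la]-measure. And its
    [p]-th moment for [mu] is at most that of [1 - t] over [A], up to errors
    coming from [U `\` A] and from the size of [Q] off [U]. Inner regularity is
    used for [la] and outer regularity for [mu]. *)
Lemma approx_dist_cut p (mu : {finite_measure set Gamma -> \bar R})
    (t : Gamma -> R[i]) (B e : R) (A : set Gamma) :
  1 <= p -> regular_measure mu -> trig_poly (~` [set 0]) t -> 1 <= B ->
  (forall g, normc (1 - t g) <= B) -> 0 < e -> measurable A ->
  (la (~` A) < ((8 * B)^-1)%:E)%E ->
  (approx_dist p mu (~` [set 0%R]) <=
   (2 `^ p)%:E * (\int[mu]_(g in A) (normc (1 - t g) `^ p)%:E + e%:E))%E.
Proof.
move=> p1 reg tt B1 tB e0 mA laA.
have p0 : 0 <= p by exact: le_trans p1.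
have B0 : 0 < B by exact: lt_le_trans B1.
pose M := B `^ p; have M0 : 0 < M by exact: powR_gt0.
pose m := fine (mu setT).
have m0 : 0 <= m by exact: fine_ge0.
have muT : mu setT = m%:E by rewrite fineK// fin_num_measure.
have r0 : 0 < (8 * B)^-1 by rewrite invr_gt0 mulr_gt0.
have [K [cK KA laK]] := regular_inner la_haar.1 mA r0.
have s0 : 0 < e / (2 * M) by rewrite divr_gt0// mulr_gt0.
have [U [oU AU muU]] := regular_outer reg mA s0.
pose c := Num.min (8 * B)^-1 (e / (2 * M * (m + 1))).
have c0 : 0 < c.
  by rewrite lt_min r0 divr_gt0// mulr_gt0 ?mulr_gt0// ltr_wpDl.
have [Q [tQ Q01 QK QU]] := trig_urysohn cK oU (subset_trans KA AU) c0.
have Q0 g : 0 <= Q g by case/andP: (Q01 g).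
have Q1 g : Q g <= 1 by case/andP: (Q01 g).
have mU := dual_open_measurable oU; have mK := dual_compact_measurable cK.
have tf := trig_poly_sub1 tt.
have mf := trig_poly_normc_measurable tf.
have mQ := dual_continuous_measurable (real_trig_poly_continuous tQ).
have [k [u [tu Pku]]] := trig_poly_constant_term (trig_polyM tf tQ).
have Pku' g : k + u g = (1 - t g) * (Q g)%:C.
  by rewrite -[LHS]/((fun g => k + u g) g) -Pku.
have nP g : normc (k + u g) = normc (1 - t g) * Q g.
  by rewrite Pku' normcM /= expr0n addr0 sqrtr_sqr ger0_norm.
have k2 : 2^-1 <= complex.Re k.
  have tv : trig_poly (~` [set 0]) (fun g => (-1) * t g + (-1) * u g).
    by apply: trig_polyD; exact: trig_polyZ.
  have := constant_term_ge la_haar separates (1 - k) tv.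
  have nf g : normc (1 - k + (-1 * t g + -1 * u g)) = normc (1 - t g) * (1 - Q g).
    have -> : 1 - k + (-1 * t g + -1 * u g) = (1 - t g) * (1 - Q g)%:C.
      rewrite rmorphB/= mulrBr mulr1 -Pku'; ring.
    by rewrite normcM /= expr0n addr0 sqrtr_sqr ger0_norm// subr_ge0.
  under eq_integral do rewrite nf.
  have mKC : measurable (~` K) by exact: measurableC.
  have mh : measurable_fun setT (fun g => normc (1 - t g) * (1 - Q g)).
    by apply: measurable_funM => //; exact: measurable_funB.
  have laKC : (la (~` K) <= ((8 * B)^-1 + (8 * B)^-1)%:E)%E.
    rewrite (_ : ~` K = ~` A `|` A `\` K); last first.
      apply/seteqP; split=> x /=; last by move=> [nA /KA|[]].
      by move=> nK; have [Ax|] := pselect (A x); [right|left].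
    apply: (le_trans (measureU2 _ _ _)).
    - exact: measurableC.
    - exact: measurableD.
    by rewrite EFinD leeD// ltW.
  (* Three terms of size 1/8 each, which leaves 5/8 > 1/2 for Re k. *)
  have le_int : (\int[la]_g (normc (1 - t g) * (1 - Q g))%:E <=
      (B * ((8 * B)^-1 + (8 * B)^-1) + B * (8 * B)^-1)%:E)%E.
    apply: le_trans (@le_integral_split _ _ _ la _ (fun=> 0) set0 (~` K) B
      (B * (8 * B)^-1) _ mKC mh _ _ _ _ _ _ _ _) _ => //.
    - exact: ltW.
    - by rewrite mulr_ge0// ltW.
    - by move=> x; rewrite mulr_ge0 ?normc_ge0// subr_ge0.
    - move=> x _ _; rewrite -[leRHS]mulr1 ler_pM ?normc_ge0 ?subr_ge0//.
      by rewrite gerBl.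
    - move=> x _ /contrapT Kx; rewrite ler_pM ?normc_ge0 ?subr_ge0//.
      rewrite lerBlDr; have := QK x Kx.
      have : c <= (8 * B)^-1 by rewrite ge_min lexx.
      by move=> ? ?; lra.
    rewrite integral_set0 add0e [X in (_ + _ * X)%E](_ : _ = 1%E); last first.
      exact: probability_setT.
    by rewrite mule1 EFinD leeD// EFinM lee_wpmul2l// lee_fin ltW.
  move=> /le_trans /(_ le_int).
  rewrite lee_fin raddfB/= mulrDr invfM mulrCA divff ?gt_eqF// mulr1.
  by move=> ?; lra.
apply: le_trans (approx_dist_le mu p1 tu k2) _.
rewrite lee_wpmul2l ?lee_fin ?powR_ge0//.
have mF := measurable_normc_powR p tf.
apply: (@le_trans _ _ (\int[mu]_g (normc (1 - t g) `^ p * Q g)%:E)%E).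
  apply: ge0_le_integral => //.
  - by move=> g _; rewrite lee_fin powR_ge0.
  - apply/measurable_EFinP.
    under eq_fun do rewrite nP powRM ?normc_ge0//.
    apply: measurable_funM => //.
    by apply: (@measurableT_comp _ _ _ _ _ _ (@powR R ^~ p)) => //; exact: measurable_powR.
  - by apply/measurable_EFinP; exact: measurable_funM.
  move=> g _; rewrite lee_fin nP powRM ?normc_ge0// ler_wpM2l ?powR_ge0//.
  have := Q0 g; rewrite le_eqVlt => /orP[/eqP <-|Qg].
    by rewrite powR0// gt_eqF// (lt_le_trans _ p1).
  by rewrite ge1r_powR// Qg Q1.
have FM g : normc (1 - t g) `^ p <= M.
  by apply: ge0_ler_powR; rewrite ?nnegrE ?normc_ge0// ltW.
apply: le_trans (@le_integral_split _ _ _ mu _ (fun g => normc (1 - t g) `^ p)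
    A (U `\` A) M (M * (e / (2 * M * (m + 1)))) _ _ _ _ _ _ _ _ _ _ _) _ => //.
- exact: measurableD.
- exact: measurable_funM.
- exact: ltW.
- by rewrite mulr_ge0 ?(ltW M0)// divr_ge0 ?(ltW e0)// !mulr_ge0 ?(ltW M0)// addr_ge0.
- by move=> g; rewrite mulr_ge0// powR_ge0.
- by move=> g; rewrite powR_ge0.
- by move=> g _; rewrite ler_piMr// powR_ge0.
- by move=> g _ _; rewrite -[leRHS]mulr1 ler_pM// powR_ge0.
- move=> g nA nUA; rewrite ler_pM ?powR_ge0//.
  apply: le_trans (QU g _) _; first by move=> Ug; apply: nUA.
  by rewrite ge_min lexx orbT.
rewrite -addeA leeD2l// [X in (_ + _ * X)%E](_ : _ = m%:E)//.
apply: (@le_trans _ _ ((M * (e / (2 * M)))%:E + (M * (e / (2 * M * (m + 1))) * m)%:E)%E).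
  by rewrite leeD// EFinM lee_wpmul2l ?lee_fin ?ltW.
rewrite -EFinD lee_fin.
have -> : M * (e / (2 * M)) = e / 2 by field; rewrite gt_eqF.
have -> : M * (e / (2 * M * (m + 1))) * m = (e / 2) * (m / (m + 1)).
  by field; rewrite !gt_eqF// ltr_wpDl.
rewrite [leRHS](splitr e) lerD2l ler_piMr//; first by rewrite divr_ge0// ltW.
by rewrite ler_pdivrMr ?ltr_wpDl// mul1r lerDl.
Qed.
End cut.

(** * Convergence of the distances *)

Section eventually.
Local Open Scope charge_scope.
Variables (R : realType) (G : zmodType).
Local Notation Gamma := (dual R G).
Variables (la : probability Gamma R) (la_haar : normalized_haar la).
Hypothesis separates : forall x : G, x <> 0 -> exists g : Gamma, g x != 1.

(** Fix a competitor [t] that is good for [mu0]. Outside the set [D] where the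
    densities of [mu n] and [mu0] differ by at least [a], it is almost as good for
    [mu n]. The cut-off is made on the complement of [D], enlarged by a
    [nu]-null subset [N] of [D] so that the rest has small [la]-measure;
    [N] has measure 0 for [mu n] and costs nothing. *)
Lemma approx_dist_near0 p (mu0 : {finite_measure set Gamma -> \bar R})
    (mu : nat -> {finite_measure set Gamma -> \bar R}) (e : R) :
  1 <= p -> (forall n, nonzero_regular (mu n)) -> m_lim mu mu0 ->
  approx_dist p mu0 (~` [set 0]) = 0%E -> 0 < e ->
  \forall n \near \oo, (approx_dist p (mu n) (~` [set 0%R]) <= e%:E)%E.
Proof.
move=> p1 muM [nu [_ mu0nu munu cvg_nu]] d0 e0.
(* Three errors: the moment of 1 - t for mu0, the gap between the densities, and
   the cut-off; the factor 2 `^ p comes from dividing by the constant term. *)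
pose e' := e / (3 * 2 `^ p).
have p2 : 0 < 2 `^ p :> R by exact: powR_gt0.
have e'0 : 0 < e' by rewrite divr_gt0// mulr_gt0.
have : (approx_dist p mu0 (~` [set 0%R]) < e'%:E)%E by rewrite d0 lte_fin.
move=> /ereal_inf_lt[_ [t tt <-] t_small].
have [B0 tB0] := trig_poly_bounded (trig_poly_sub1 tt).
pose B := Num.max 1 B0.
have B1 : 1 <= B by rewrite le_max lexx.
have Bgt0 : 0 < B by exact: lt_le_trans B1.
have tB g : normc (1 - t g) <= B by rewrite (le_trans (tB0 g))// le_max lexx orbT.
pose M := B `^ p; have M0 : 0 < M by exact: powR_gt0.
pose m := fine (nu setT).
have m0 : 0 <= m by exact: fine_ge0.
have nuT : nu setT = m%:E by rewrite fineK// fin_num_measure.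
pose a := e' / (M * (m + 1)).
have a0 : 0 < a by rewrite divr_gt0// mulr_gt0// ltr_wpDl.
have r0 : 0 < (8 * B)^-1 by rewrite invr_gt0 mulr_gt0.
have [b b0 small] := small_modulo_null nu la r0.
have : \forall n \near \oo, (nu [set g |
    (a%:E <= `|('d (charge_of_finite_measure (mu n)) '/d nu) g -
               ('d (charge_of_finite_measure mu0) '/d nu) g|)%E] < b%:E)%E.
  apply: (cvg_nu a a0 [set y | (y < b%:E)%E]); apply: open_nbhs_nbhs.
  split; first exact: open_ereal_lt_ereal.
  by rewrite /= lte_fin.
apply: filterS => n.
set D := (X in nu X) => nuD.
have mRN (k : {finite_measure set Gamma -> \bar R}) : k `<< nu ->
    measurable_fun setT ('d (charge_of_finite_measure k) '/d nu).
  by move=> knu; apply: (measurable_int nu); exact: Radon_Nikodym_integrable.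
have mD : measurable D.
  rewrite -[D]setTI; apply: emeasurable_fun_c_infty => //.
  apply: measurableT_comp => //.
  by apply: emeasurable_funB; exact: mRN.
have [N [mN ND nuN laDN]] := small D mD nuD.
have mDC : measurable (~` D) by exact: measurableC.
have AC : ~` (~` D `|` N) = D `\` N by rewrite setCU setCK setDE.
have mF := measurable_normc_powR p (trig_poly_sub1 tt).
have FM g : 0 <= normc (1 - t g) `^ p <= M.
  rewrite powR_ge0/=; apply: ge0_ler_powR; rewrite ?nnegrE ?normc_ge0 ?(ltW Bgt0)//.
  exact: le_trans p1.
have := approx_dist_cut la_haar separates (A := ~` D `|` N) p1 (muM n).1 tt B1 tB e'0
  (measurableU _ _ mDC mN).
rewrite AC => /(_ laDN) /le_trans; apply.
rewrite ge0_integral_setU//; last 3 first.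
- by apply/measurable_EFinP; exact: measurable_funTS.
- by move=> x _; rewrite lee_fin powR_ge0.
- by apply/disj_set2P; rewrite disjoints_subset; exact: subsetC.
rewrite [X in (_ + X + _)%E]null_set_integral//; last 2 first.
- by apply/measurable_EFinP; exact: measurable_funTS.
- by move/null_content_dominatesP : (munu n); exact.
rewrite adde0.
apply: (@le_trans _ _ ((2 `^ p)%:E * ((e' + a * M * m)%:E + e'%:E))%E).
  rewrite lee_wpmul2l ?lee_fin ?powR_ge0// leeD2r//.
  apply: le_trans (@integral_le_of_density_close _ _ _ nu mu0 (mu n) a M _ (~` D)
    mu0nu (munu n) (ltW a0) mDC _ mF FM) _.
    by move=> x /= /negP; rewrite -ltNge => /ltW.
  rewrite [X in (_ + _ * X)%E](_ : _ = m%:E)// -EFinM EFinD leeD//; exact: ltW.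
rewrite -EFinD -EFinM lee_fin.
have aMm : a * M * m <= e'.
  rewrite /a (_ : _ * M * m = e' * (m / (m + 1))); last first.
    by field; rewrite !gt_eqF// ltr_wpDl.
  by rewrite ler_piMr ?(ltW e'0)// ler_pdivrMr ?ltr_wpDl// mul1r lerDl.
have <- : 2 `^ p * (e' + e' + e') = e by rewrite /e'; field; rewrite gt_eqF.
by rewrite ler_wpM2l ?powR_ge0//; lra.
Qed.
End eventually.

Theorem corollary4p7 (R : realType) (G : zmodType)
    (G_nontrivial : exists x : G, x <> 0)
    (la : probability (dual R G) R) (la_haar : normalized_haar la)
    (p : R) (p_ge1 : 1 <= p)
    (mu0 : {finite_measure set (dual R G) -> \bar R})
    (mu : nat -> {finite_measure set (dual R G) -> \bar R})
    (mu0M : nonzero_regular mu0) (muM : forall n, nonzero_regular (mu n))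
    (mu0_ac : mu0 `<< la) (mu_ac : forall n, mu n `<< la)
    (mu_lim : m_lim mu mu0)
    (d0 : approx_dist p mu0 (~` [set 0]) = 0%E) :
  approx_dist p (mu n) (~` [set 0]) @[n --> \oo]
    --> approx_dist p mu0 (~` [set 0]).
Proof.
rewrite d0.
have [[x [x0 x1]]|separates] :=
  pselect (exists x : G, x <> 0 /\ forall g : dual R G, g x = 1).
  under eq_fun do rewrite (approx_dist_trivial_char _ p_ge1 x0 x1).
  exact: cvg_cst.
have sep (x : G) : x <> 0 -> exists g : dual R G, g x != 1.
  move=> x0; apply: contrapT => h; apply: separates; exists x; split => // g.
  by apply/eqP/negP => /negP gx; apply: h; exists g.
have near_e e := @approx_dist_near0 _ _ _ la_haar sep _ _ mu e p_ge1 muM mu_lim d0.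
apply/fine_cvgP; split.
  near=> n; rewrite ge0_fin_numE ?approx_dist_ge0//.
  apply: le_lt_trans (ltry 1); near: n; exact: near_e.
apply/cvgrPdist_le => e e0; near=> n.
have : (approx_dist p (mu n) (~` [set 0%R]) <= e%:E)%E by near: n; exact: near_e.
have := approx_dist_ge0 p (mu n) (~` [set 0%R]); rewrite /=.
case: (approx_dist _ _ _) => [r| |]//=.
by rewrite !lee_fin sub0r normrN => r0 re; rewrite ger0_norm.
Unshelve. all: by end_near.
Qed.
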